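(* Let $f:\mathbb{R}^n\to\mathbb{R}$ be bounded below, $L_0$-Lipschitz and $L_1$-smooth, i.e. $|f(x)-f(y)|\le L_0\|x-y\|$ and $\|\nabla f(x)-\nabla f(y)\|\le L_1\|x-y\|$ for all $x,y\in\mathbb{R}^n$. Run the asynchronous residual-feedback algorithm (defined in the context) with step size $\alpha>0$ and smoothing parameter $\mu>0$. Then for every $k\ge 1$, $$\mathbb{E}\left[\|G_{\tilde\mu}(x_k)\|^2\right]\le \frac{2\bar n L_0^2\alpha^2 k}{\mu^2}\sum_{m=0}^{k-1}(1-p_{\min})^{m}\,\mathbb{E}\left[\|G_{\tilde\mu}(x_{k-m-1})\|^2\right]+4L_0^2\left((4+\bar n)^2+\bar n^2\right),$$ where $p_{\min}=\min_i p_i$ and the expectations are taken with respect to the random exploration directions and the random indices of activated agents.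
   Context: Setting. There are $N$ agents; the joint decision vector is $x=(x^1,\dots,x^N)\in\mathbb{R}^n$, where agent $i$ controls the block $x^i\in\mathbb{R}^{\bar n}$ (all blocks have the same dimension $\bar n$, so $n=N\bar n$). All agents use the same step size $\alpha$ and the same smoothing parameter $\mu$ (so $\mu_i=\mu$ for all $i$). Asynchrony model. $P=(p_1,\dots,p_N)$ is a fixed probability distribution. At each time step $k=0,1,2,\dots$ one agent $i_k$ is selected, independently of everything before, with $\mathbb{P}(i_k=i)=p_i$. The selected agent queries the (noiseless) value of $f$ once and updates its own block; the other blocks are unchanged. Algorithm. Start at a deterministic $x_0\in\mathbb{R}^n$. At step $k$, if $i_k=i$, a vector $u_k\in\mathbb{R}^n$ is drawn, independent of the past, whose $i$-th block is $\mathcal{N}(0,I_{\bar n})$ and whose other blocks are zero. The gradient estimate is $$G_{\mu_i}(x_k)=\frac{f(x_k+\mu u_k)-f(x_{\ell}+\mu u_{\ell})}{\mu}\,u_k ,$$ where $\ell<k$ is the (random) most recent time step before $k$ at which agent $i$ was selected. If agent $i$ has not been selected before step $k$ (in particular if $k=0$), the previous value is taken to be $f(x_0+\mu v_i)$, with $v_i\in\mathbb{R}^n$ an initial direction having $i$-th block $\mathcal{N}(0,I_{\bar n})$ and other blocks zero, independent of everything else. The update is $x_{k+1}=x_k-\alpha\,G_{\mu_i}(x_k)$ with $i=i_k$. Notation. $\mathbb{E}[\|G_{\tilde\mu}(x_k)\|^2]:=\mathbb{E}_{i_k}\big[\mathbb{E}[\|G_{\mu_i}(x_k)\|^2\mid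 i_k=i]\big]=\sum_{i=1}^N p_i\,\mathbb{E}[\|G_{\mu_i}(x_k)\|^2\mid i_k=i]$, the inner expectation being over all random directions up to step $k$ and all activated indices before step $k$. *)

(* Defs.v *)
From HB Require Import structures.
From mathcomp Require Import all_boot all_order all_algebra.
From mathcomp Require Import all_classical all_reals all_analysis.
Set Implicit Arguments.
Unset Strict Implicit.
Unset Printing Implicit Defensive.
Import Order.TTheory GRing.Theory Num.Theory.
Import numFieldNormedType.Exports.
Local Open Scope classical_set_scope.
Local Open Scope ring_scope.

(* Joint decision vectors x = (x^1, ..., x^N), with N blocks of dimension nbar,
   are N x nbar matrices: row i is the block x^i. The canonical norm on
   matrices is the sup norm; the Euclidean one is [enorm]. *)
Definition enorm {R : realType} {N nbar : nat} (x : 'M[R]_(N, nbar)) : R :=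
  Num.sqrt (\sum_(i < N) \sum_(j < nbar) x i j ^+ 2).

Definition gradient {R : realType} {N nbar : nat} (f : 'M[R]_(N, nbar) -> R)
    (x : 'M[R]_(N, nbar)) : 'M[R]_(N, nbar) :=
  \matrix_(i, j) 'D_(delta_mx i j) f x.

Definition lipschitz_with {R : realType} {N nbar : nat} (L0 : R)
    (f : 'M[R]_(N, nbar) -> R) : Prop :=
  forall x y, `|f x - f y| <= L0 * enorm (x - y).

Definition smooth_with {R : realType} {N nbar : nat} (L1 : R)
    (f : 'M[R]_(N, nbar) -> R) : Prop :=
  (forall x, differentiable f x) /\
  (forall x y, enorm (gradient f x - gradient f y) <= L1 * enorm (x - y)).

Definition bounded_below {R : realType} {N nbar : nat}
    (f : 'M[R]_(N, nbar) -> R) : Prop :=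
  exists M : R, forall x, M <= f x.

Definition probability_vector {R : realType} {N : nat} (p : 'I_N -> R) : Prop :=
  (forall i, 0 <= p i) /\ \sum_(i < N) p i = 1.

(* The neutral element 1 is harmless for a probability vector: N > 0 and
   every p i is at most 1. *)
Definition pmin {R : realType} {N : nat} (p : 'I_N -> R) : R :=
  \big[Num.min/1]_(i < N) p i.

(* The vector whose i-th block is g and whose other blocks are zero. *)
Definition block_vec {R : realType} {N nbar : nat} (i : 'I_N)
    (g : 'I_nbar -> R) : 'M[R]_(N, nbar) :=
  \matrix_(a, j) (if a == i then g j else 0).

(* Most recent time l < k at which agent i was selected, if any. *)
Fixpoint last_selected {N : nat} (s : nat -> 'I_N) (i : 'I_N) (k : nat) :
    option nat :=
  if k is l.+1 then
    if s l == i then Some l else last_selected s i l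
  else None.

(* One realization of the algorithm: s k is the agent selected at time k, z k
   the nonzero block of the direction u_k, w i the nonzero block of the initial
   direction v_i, and x the sequence of iterates. [residual_grad] is the
   gradient estimate of agent i at time k; it is meaningful when s k = i. *)
Definition residual_grad {R : realType} {N nbar : nat}
    (f : 'M[R]_(N, nbar) -> R) (mu : R) (x0 : 'M[R]_(N, nbar))
    (s : nat -> 'I_N) (z : nat -> 'I_nbar -> R) (w : 'I_N -> 'I_nbar -> R)
    (x : nat -> 'M[R]_(N, nbar)) (i : 'I_N) (k : nat) : 'M[R]_(N, nbar) :=
  let u := fun t => block_vec (s t) (z t) in
  let v := fun a => block_vec a (w a) in
  let previous := if last_selected s i k is Some l then f (x l + mu *: u l)
                  else f (x0 + mu *: v i) in
  ((f (x k + mu *: u k) - previous) / mu) *: u k.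

Definition residual_feedback_run {R : realType} {N nbar : nat}
    (f : 'M[R]_(N, nbar) -> R) (alpha mu : R) (x0 : 'M[R]_(N, nbar))
    (s : nat -> 'I_N) (z : nat -> 'I_nbar -> R) (w : 'I_N -> 'I_nbar -> R)
    (x : nat -> 'M[R]_(N, nbar)) : Prop :=
  x 0%N = x0 /\
  forall k, x k.+1 = x k - alpha *: residual_grad f mu x0 s z w x (s k) k.

Definition mutually_independent {d : measure_display} {T : measurableType d}
    {R : realType} (P : probability T R) {I : eqType}
    (F : I -> set_system T) : Prop :=
  forall (r : seq I) (A : I -> set T), uniq r ->
    (forall t, t \in r -> F t (A t)) ->
    P (\bigcap_(t in [set` r]) A t) = (\prod_(t <- r) P (A t))%E.

Definition source (N nbar : nat) : eqType :=
  (nat + nat * 'I_nbar + 'I_N * 'I_nbar)%type.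

(* The sigma-algebras generated by the elementary sources of randomness: the
   selected agents, the coordinates of the exploration directions and those of
   the initial directions. *)
Definition source_sigma {d : measure_display} {T : measurableType d}
    {R : realType} {N nbar : nat} (idx : nat -> T -> 'I_N)
    (z : nat -> 'I_nbar -> T -> R) (w : 'I_N -> 'I_nbar -> T -> R)
    (t : source N nbar) : set_system T :=
  match t with
  | inl (inl k) => preimage_set_system setT (idx k) setT
  | inl (inr (k, j)) => preimage_set_system setT (z k j) measurable
  | inr (i, j) => preimage_set_system setT (w i j) measurable
  end.

Definition standard_normal {d : measure_display} {T : measurableType d}
    {R : realType} (P : probability T R) (X : {RV P >-> R}) : Prop :=
  forall A : set R, measurable A -> distribution P X A = normal_prob 0 1 A.

(* Elementary conditional expectation given the event A; it is 0 if P A = 0. *)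
Definition cond_expectation {d : measure_display} {T : measurableType d}
    {R : realType} (P : probability T R) (A : set T) (X : T -> R) : \bar R :=
  (((fine (P A))^-1)%:E * \int[P]_(w in A) (X w)%:E)%E.

Definition mean_sq_grad {d : measure_display} {T : measurableType d}
    {R : realType} (P : probability T R) {N nbar : nat} (p : 'I_N -> R)
    (f : 'M[R]_(N, nbar) -> R) (mu : R) (x0 : 'M[R]_(N, nbar))
    (idx : nat -> T -> 'I_N) (z : nat -> 'I_nbar -> T -> R)
    (w : 'I_N -> 'I_nbar -> T -> R) (x : nat -> T -> 'M[R]_(N, nbar))
    (k : nat) : \bar R :=
  (\sum_(i < N) (p i)%:E *
     cond_expectation P (idx k @^-1` [set i])
       (fun t => (enorm (residual_grad f mu x0 (idx ^~ t)
                          (fun l j => z l j t) (fun a j => w a j t)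
                          (x ^~ t) i k) ^+ 2)%R))%E.

(* Main.v *)
Require Import Defs.
From HB Require Import structures.
From mathcomp Require Import all_boot all_order all_algebra.
From mathcomp Require Import all_classical all_reals all_analysis.
From mathcomp Require Import measurable_realfun ring lra.
Import Order.TTheory GRing.Theory Num.Theory.
Import numFieldNormedType.Exports.
Set Implicit Arguments.
Unset Strict Implicit.
Unset Printing Implicit Defensive.
Local Open Scope classical_set_scope.
Local Open Scope ring_scope.

(* Fix an agent [i]. On the event that [i] is selected at time [k], let
   [x_l + mu u_l] be the point of its previous query ([x_0 + mu v_i] if there is
   none). The Lipschitz bound gives
     |G|^2 <= (2 L0^2 / mu^2) |x_k - x_l|^2 |u_k|^2
              + 4 L0^2 (|u_k|^4 + |u_l|^2 |u_k|^2),
   and [|x_k - x_l|^2 <= alpha^2 k D_k] by Cauchy-Schwarz, where [D_k] is the sum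
   of [|G_t|^2] over [l <= t < k]. Since [D_(k+1) = 1(i_k <> i) D_k + |G_k|^2]
   and [i_k] is independent of the past,
     E D_k = sum_(m < k) (1 - p_i)^m E |G_(k-m-1)|^2.
   As [u_k] is independent of [(D_k, u_l)], there remain only the moments
   [E |u_k|^2 <= nbar], [E |u_l|^2 <= nbar] and [E |u_k|^4 <= nbar^2 + 2 nbar].
   All integrands are nonnegative and all expectations are taken in the extended
   reals, so no integrability has to be established. *)

(** * Independence of sigma-algebras generated by disjoint sets of sources *)

Lemma bigcap_seqE {T : Type} {I : eqType} (r : seq I) (A : I -> set T) :
  \bigcap_(t in [set` r]) A t = \big[setI/setT]_(t <- r) A t.
Proof.
elim: r => [|u r IH]; first by rewrite big_nil set_nil bigcap_set0.
rewrite big_cons -IH; apply/seteqP; split => [x Ax|x [Aux Ax] t].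
  split=> [|t /= tr]; apply: Ax; first exact: mem_head.
  by rewrite /= inE tr orbT.
by rewrite /= inE => /predU1P[->|/Ax].
Qed.

(** Measurability with respect to a sub-sigma-algebra becomes ordinary [measurable_fun] on this
    retyped copy of [T], so the closure lemmas for measurable functions apply to [depends_on]
    directly. *)
Definition sub_space {d : measure_display} {T : measurableType d} {I : eqType}
    (F : I -> set_system T) (S : set I) :=
  g_sigma_algebraType (\bigcup_(t in S) F t).

Definition depends_on {d d' : measure_display} {T : measurableType d}
    {T' : measurableType d'} {I : eqType} (F : I -> set_system T) (S : set I)
    (X : T -> T') : Prop :=
  measurable_fun (setT : set (sub_space F S)) (X : sub_space F S -> T').

Section independence.
Context {d : measure_display} {T : measurableType d} {R : realType}.
Variables (P : probability T R) (I : eqType) (F : I -> set_system T).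
Hypothesis F_meas : forall t, F t `<=` measurable.
Hypothesis F_setI : forall t, setI_closed (F t).
Hypothesis F_setT : forall t, F t setT.

Lemma sub_sigma_measurable (S : set I) (A : set T) :
  <<s \bigcup_(t in S) F t >> A -> measurable A.
Proof.
apply: smallest_sub; last by move=> B [t _]; exact: F_meas.
exact: (@sigma_algebra_measurable d T).
Qed.

Lemma depends_on_measurable d' (T' : measurableType d') S (X : T -> T') :
  depends_on F S X -> measurable_fun setT X.
Proof. by move=> mX _ B mB; apply: (@sub_sigma_measurable S); exact: mX. Qed.

Lemma sub_sigmaW (S S' : set I) : S `<=` S' ->
  <<s \bigcup_(t in S) F t >> `<=` <<s \bigcup_(t in S') F t >>.
Proof.
move=> SS'; apply: sub_sigma_algebra2 => A [t St FA].
by exists t => //; exact: SS'.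
Qed.

Lemma depends_onW d' (T' : measurableType d') S S' (X : T -> T') : S `<=` S' ->
  depends_on F S X -> depends_on F S' X.
Proof. by move=> SS' mX _ B mB; apply: (sub_sigmaW SS'); exact: mX. Qed.

(** A pi-system generating the sigma-algebra of [S], on which [mutually_independent] can be read off
    because [r] names each source once. *)
Definition cylinder (S : set I) : set_system T :=
  [set A | exists (r : seq I) (a : I -> set T), [/\ uniq r,
     (forall t, t \in r -> S t /\ F t (a t)) &
     A = \bigcap_(t in [set` r]) a t]].

Lemma sub_cylinder S : \bigcup_(t in S) F t `<=` cylinder S.
Proof.
move=> A [t St FA]; exists [:: t], (fun=> A); split => //.
  by move=> u; rewrite inE => /eqP ->.
by rewrite set_cons1 bigcap_set1.
Qed.

Lemma cylinder_setI S : setI_closed (cylinder S).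
Proof.
move=> _ _ [r [a [_ ra ->]]] [r' [a' [_ ra' ->]]].
(* A source occurring in both lists gets the intersection of its two events; [setT] fills in where
   it occurs in only one. *)
exists (undup (r ++ r')), (fun t => (if t \in r then a t else setT) `&`
  (if t \in r' then a' t else setT)); split; first exact: undup_uniq.
- move=> t; rewrite mem_undup mem_cat => tr; split.
    by case/orP: tr => [/ra[]|/ra'[]].
  apply: F_setI.
    by case: ifPn => // /ra[].
  by case: ifPn => // /ra'[].
- apply/seteqP; split => [x [rx r'x] t /= _|x rx].
    by split; case: ifPn => // tr; [exact: rx|exact: r'x].
  split=> t /= tr; (have := rx t; rewrite /= mem_undup mem_cat tr ?orbT).
    by case=> [//|+ _].
  by case=> [//|].
Qed.

Lemma cylinder_measurable S : cylinder S `<=` measurable.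
Proof.
move=> _ [r [a [_ ra ->]]]; rewrite bigcap_seqE big_seq.
by apply: bigsetI_measurable => t /ra[_]; exact: F_meas.
Qed.

Lemma cylinder_setT S : cylinder S setT.
Proof.
by exists [::], (fun=> setT); split => //; rewrite set_nil bigcap_set0.
Qed.

Lemma sub_sigma_cylinder S :
  <<s \bigcup_(t in S) F t >> `<=` <<s cylinder S >>.
Proof. apply: sub_sigma_algebra2; exact: sub_cylinder. Qed.

Hypothesis indep : mutually_independent P F.

(** Since [S] and [S'] are disjoint, the concatenated list of sources is still duplicate-free, so
    independence applies to it as well as to its two halves. *)
Lemma indep_cylinder S S' A B : S `&` S' = set0 ->
  cylinder S A -> cylinder S' B -> P (A `&` B) = (P A * P B)%E.
Proof.
move=> SS' [r [a [ru ra ->]]] [r' [a' [ru' ra' ->]]].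
have rr' t : t \in r' -> t \notin r.
  move=> /ra'[S't _]; apply/negP => /ra[St _].
  by have : (S `&` S') t by []; rewrite SS'.
pose b t := if t \in r then a t else a' t.
have br : {in r, b =1 a} by move=> t tr; rewrite /b tr.
have br' : {in r', b =1 a'} by move=> t /rr' /negbTE tr; rewrite /b tr.
have Fb t : t \in r ++ r' -> F t (b t).
  rewrite mem_cat => /orP[tr|tr'].
    by rewrite br//; case: (ra _ tr).
  by rewrite br'//; case: (ra' _ tr').
have rru : uniq (r ++ r').
  rewrite cat_uniq ru ru' andbT /=; apply/hasPn => t; exact: rr'.
rewrite -(eq_bigcapr br) -(eq_bigcapr br').
have -> : \bigcap_(t in [set` r]) b t `&` \bigcap_(t in [set` r']) b t =
    \bigcap_(t in [set` r ++ r']) b t.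
  by rewrite !bigcap_seqE big_cat.
rewrite !indep// ?big_cat//= => t tr; apply: Fb; rewrite mem_cat tr//.
by rewrite orbT.
Qed.

(** For fixed [B], the finite measures sending [A] to the probability of its intersection with [B]
    and to [P A * P B] agree on the pi-system of cylinders, hence on the sigma-algebra it
    generates. *)
Lemma indep_sub_sigma_cylinder S S' A B : S `&` S' = set0 ->
  <<s \bigcup_(t in S) F t >> A -> cylinder S' B -> P (A `&` B) = (P A * P B)%E.
Proof.
move=> SS' /sub_sigma_cylinder SA S'B.
have mB := cylinder_measurable S'B.
have PB : (0 <= fine (P B))%R by exact: fine_ge0.
have PBE : P B = (fine (P B))%:E by rewrite fineK// fin_num_measure.
have := @g_sigma_algebra_measure_unique d R T (cylinder S)
  (@cylinder_measurable S) (fun=> setT) (fun=> cylinder_setT S).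
move=> /(_ _ (mrestr P mB) (mscale (NngNum PB) P)).
move=> /(_ (bigcup_const _ (ex_intro _ 0%N Logic.I)) (@cylinder_setI S)).
have mE C : mscale (NngNum PB) P C = (P C * P B)%E.
  by rewrite /mscale/= -PBE muleC.
rewrite -mE => <-//.
- by move=> C SC; apply: etrans (esym (mE C)); exact: indep_cylinder SS' SC S'B.
- by move=> _; rewrite /= /mrestr setTI PBE ltry.
Qed.

(** The same uniqueness argument in the other variable: [A] is now fixed in the sigma-algebra of
    [S], and the previous lemma gives agreement on the cylinders of [S']. *)
Lemma indep_sub_sigma S S' A B : S `&` S' = set0 ->
  <<s \bigcup_(t in S) F t >> A -> <<s \bigcup_(t in S') F t >> B ->
  P (A `&` B) = (P A * P B)%E.
Proof.
move=> SS' SA /sub_sigma_cylinder S'B.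
have mA := sub_sigma_measurable SA.
have PA : (0 <= fine (P A))%R by exact: fine_ge0.
have PAE : P A = (fine (P A))%:E by rewrite fineK// fin_num_measure.
have := @g_sigma_algebra_measure_unique d R T (cylinder S')
  (@cylinder_measurable S') (fun=> setT) (fun=> cylinder_setT S').
move=> /(_ _ (mrestr P mA) (mscale (NngNum PA) P)).
move=> /(_ (bigcup_const _ (ex_intro _ 0%N Logic.I)) (@cylinder_setI S')).
have mE C : mscale (NngNum PA) P C = (P A * P C)%E.
  by rewrite /mscale/= -PAE.
rewrite setIC -mE => <-//.
- move=> C SC; apply: etrans (esym (mE C)); rewrite /= /mrestr setIC.
  exact: indep_sub_sigma_cylinder SS' SA SC.
- by move=> _; rewrite /= /mrestr setTI PAE ltry.
Qed.

End independence.

(** * Expectation of a product of independent nonnegative variables *)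

Lemma expectation_indepM {d : measure_display} {T : measurableType d}
    {R : realType} (P : probability T R) (X Y : T -> R) :
  measurable_fun setT X -> measurable_fun setT Y ->
  (forall t, 0 <= X t) -> (forall t, 0 <= Y t) ->
  (forall A B, measurable A -> measurable B ->
    P (X @^-1` A `&` Y @^-1` B) = (P (X @^-1` A) * P (Y @^-1` B))%E) ->
  (\int[P]_t (X t * Y t)%:E = \int[P]_t (X t)%:E * \int[P]_t (Y t)%:E)%E.
Proof.
move=> mX mY X0 Y0 XY.
have mXY : measurable_fun setT (fun t => (X t, Y t)).
  exact: measurable_fun_pair.
pose X' : {RV P >-> R} := mfun_Sub (mem_set mX).
pose Y' : {RV P >-> R} := mfun_Sub (mem_set mY).
pose XY' : {RV P >-> (R * R)%type} := mfun_Sub (mem_set mXY).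
(* The absolute value is the identity on the values of [X] and [Y], and makes the integrand
   nonnegative on the whole plane, as Tonelli requires. *)
pose na : R -> \bar R := fun x => `|x|%:E.
have na0 x : (0 <= na x)%E by rewrite lee_fin.
have mabs : measurable_fun [set: R] na.
  by apply/measurable_EFinP; exact: normr_measurable.
have XE : (\int[distribution P X']_x na x = \int[P]_t (X t)%:E)%E.
  rewrite ge0_integral_distribution//; apply: eq_integral => t _ /=.
  by rewrite /na ger0_norm.
have YE : (\int[distribution P Y']_x na x = \int[P]_t (Y t)%:E)%E.
  rewrite ge0_integral_distribution//; apply: eq_integral => t _ /=.
  by rewrite /na ger0_norm.
have mprod : measurable_fun [set: R * R] (fun z => na z.1 * na z.2)%E.
  by apply: emeasurable_funM; exact: measurableT_comp.
transitivity (\int[distribution P XY']_z (na z.1 * na z.2))%E.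
  rewrite ge0_integral_distribution//; last by move=> z; rewrite mule_ge0.
  by apply: eq_integral => t _ /=; rewrite /na !ger0_norm.
(* The joint law takes product values on rectangles, hence is the product of the two laws. *)
rewrite (eq_measure_integral (distribution P X' \x distribution P Y')%E);
  last first.
  by move=> A mA _; exact/esym/product_measure_unique.
rewrite fubini_tonelli1//; last by move=> z; rewrite mule_ge0.
rewrite /fubini_F -XE -YE -ge0_integralZr//; last exact: integral_ge0.
by apply: eq_integral => x _ /=; rewrite ge0_integralZl.
Qed.

Lemma expectation_depends_onM {d : measure_display} {T : measurableType d}
    {R : realType} (P : probability T R) (I : eqType) (F : I -> set_system T)
    (F_meas : forall t, F t `<=` measurable)
    (F_setI : forall t, setI_closed (F t)) (F_setT : forall t, F t setT)
    (indep : mutually_independent P F) (S S' : set I) (X Y : T -> R) :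
  S `&` S' = set0 -> depends_on F S X -> depends_on F S' Y ->
  (forall t, 0 <= X t) -> (forall t, 0 <= Y t) ->
  (\int[P]_t (X t * Y t)%:E = \int[P]_t (X t)%:E * \int[P]_t (Y t)%:E)%E.
Proof.
move=> SS' SX S'Y X0 Y0; apply: expectation_indepM => //.
- exact: depends_on_measurable SX.
- exact: depends_on_measurable S'Y.
- move=> A B mA mB; apply: indep_sub_sigma SS' _ _ => //.
    by have := SX measurableT A mA; rewrite setTI.
  by have := S'Y measurableT B mB; rewrite setTI.
Qed.

(** * Even moments of the standard normal law *)

Lemma ge0_integral_normal_prob {R : realType} (m s : R) (f : R -> \bar R) :
  measurable_fun setT f -> (forall x, 0 <= f x)%E ->
  (\int[normal_prob m s]_x f x =
   \int[lebesgue_measure]_x (f x * (normal_pdf m s x)%:E))%E.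
Proof.
move=> mf f0; have dom := normal_prob_dominates m s.
rewrite -(Radon_Nikodym_SigmaFinite.change_of_variables dom)//.
have mpdf : measurable_fun [set: R] (EFin \o normal_pdf m s).
  by apply/measurable_EFinP; exact: measurable_normal_pdf.
have int_RN := Radon_Nikodym_SigmaFinite.f_integrable dom.
apply: ae_eq_integral => //.
- by apply: emeasurable_funM => //; exact: measurable_int int_RN.
- exact: emeasurable_funM.
(* The Radon-Nikodym derivative and the density have the same integral over every measurable set, so
   they agree almost everywhere. *)
- apply: ae_eqe_mul2l; apply: integral_ae_eq => //.
  by move=> A _ mA; rewrite -Radon_Nikodym_SigmaFinite.f_integral.
Qed.

Local Notation phi := (normal_pdf 0 1).

Lemma is_derive_std_normal_pdf {R : realType} (x : R) :
  is_derive x 1 (normal_pdf 0 1 : R -> R) (- (x * phi x)).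
Proof.
have -> : (normal_pdf 0 1 : R -> R) =
    (fun y => normal_peak 1 *: expR (- 2^-1 *: y ^+ 2)).
  apply/funext => y; rewrite normal_pdfE ?oner_eq0// /normal_fun subr0 expr1n.
  by rewrite /GRing.scale/= !mulNr (mulrC _ 2^-1).
have dX : is_derive x 1 (fun y : R => - 2^-1 *: y ^+ 2) (- x).
  apply: is_derive_eq; rewrite /GRing.scale/=.
  by field.
apply: is_derive_eq.
by rewrite /GRing.scale/=; ring.
Qed.

Lemma derivable_LRcontinuous {R : realType} (f : R -> R) (a b : R) :
  (forall x, derivable f x 1) -> derivable_oo_LRcontinuous f a b.
Proof.
move=> df; have cf x : f y @[y --> x] --> f x.
  by apply/differentiable_continuous/derivable1_diffP.
by split=> [x _ //||]; [apply: cvg_at_right_filter|apply: cvg_at_left_filter].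
Qed.

(* Integration by parts, with [phi' = - x phi]. *)
Lemma std_normal_moment_le_itv {R : realType} (n : nat) (b : R) :
  ~~ odd n -> 0 < b ->
  (\int[lebesgue_measure]_(x in `[(- b)%R, b]) (x ^+ n.+2 * phi x)%:E <=
   n.+1%:R%:E *
     \int[lebesgue_measure]_(x in `[(- b)%R, b]) (x ^+ n * phi x)%:E)%E.
Proof.
move=> n_even b_gt0.
have phi_ge0 (x : R) : 0 <= phi x := normal_pdf_ge0 0 1 x.
have xn_ge0 (x : R) : 0 <= x ^+ n by exact: exprn_even_ge0.
have Xphi_cont m : continuous (fun x : R => x ^+ m * phi x).
  move=> x; apply: cvgM; first exact: exprn_continuous.
  by apply: continuous_normal_pdf; rewrite oner_eq0.
have dXn (x : R) : is_derive x 1 (fun y => - y ^+ n.+1) (- n.+1%:R * x ^+ n).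
  have -> : (fun y : R => - y ^+ n.+1) = - (id ^+ n.+1).
    by apply/funext => y; rewrite exprfctE.
  by apply: is_derive_eq; rewrite /GRing.scale/= mulr1 mulNr.
have dphi (x : R) := is_derive_std_normal_pdf x.
have := @integration_by_parts R (fun x => - x ^+ n.+1) phi
  (fun x => - n.+1%:R * x ^+ n) (fun x => - (x * phi x)) (- b) b.
have -> : - b < b by rewrite gtrN.
move=> /(_ isT) ibp.
have {ibp} : (\int[lebesgue_measure]_(x in `[(- b)%R, b])
       (- x ^+ n.+1 * - (x * phi x))%:E)%E =
   ((- b ^+ n.+1 * phi b - - (- b) ^+ n.+1 * phi (- b))%:E -
    \int[lebesgue_measure]_(x in `[(- b)%R, b])
       (- n.+1%:R * x ^+ n * phi x)%:E)%E.
  apply: ibp.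
  - apply: continuous_subspaceT => x; apply: cvgM; first exact: cvg_cst.
    exact: exprn_continuous.
  - by apply: derivable_LRcontinuous => x; exact: ex_derive.
  - by move=> x _; rewrite derive1E; exact: derive_val.
  - apply: continuous_subspaceT => x; apply: cvgN; exact: (Xphi_cont 1%N).
  - by apply: derivable_LRcontinuous => x; exact: ex_derive.
  - by move=> x _; rewrite derive1E; exact: derive_val.
under eq_integral do rewrite mulrNN mulrA -exprSr.
move=> ->; have -> : (\int[lebesgue_measure]_(x in `[(- b)%R, b])
       (- n.+1%:R * x ^+ n * phi x)%:E =
   - (n.+1%:R%:E * \int[lebesgue_measure]_(x in `[(- b)%R, b])
       (x ^+ n * phi x)%:E))%E.
  rewrite -ge0_integralZl//; last 2 first.
  - apply/measurable_EFinP/measurable_funTS.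
    exact: continuous_measurable_fun.
  - by move=> x _; rewrite lee_fin mulr_ge0.
  rewrite -integral_ge0N => [|x _]; last by rewrite lee_fin !mulr_ge0.
  by apply: eq_integral => x _; rewrite -EFinM -EFinN -mulrA mulNr.
(* As [n.+1] is odd, the boundary term equals [- b ^+ n.+1 * (phi b + phi (- b))]; it is nonpositive
   and is dropped. *)
rewrite oppeK -[leRHS]add0e leeD2r// lee_fin exprNn -signr_odd oddS n_even.
rewrite expr1 !mulN1r opprK mulNr -opprD oppr_le0.
by rewrite addr_ge0// mulr_ge0// exprn_ge0// ltW.
Qed.

(** The bound on [[- k, k]] passes to the limit by monotone convergence on the left, after its
    right-hand side has been enlarged to the whole line. Starting from the total mass it yields the
    moments 1 and 3. *)
Lemma std_normal_moment_le {R : realType} (n : nat) : ~~ odd n ->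
  (\int[normal_prob (0 : R) 1]_x (x ^+ n.+2)%:E <=
   n.+1%:R%:E * \int[normal_prob (0 : R) 1]_x (x ^+ n)%:E)%E.
Proof.
move=> n_even.
have xn_ge0 m (x : R) : ~~ odd m -> (0 <= (x ^+ m)%:E)%E.
  by move=> m_even; rewrite lee_fin exprn_even_ge0.
have n2_even : ~~ odd n.+2 by rewrite /= negbK.
have mX m : measurable_fun setT (fun x : R => (x ^+ m)%:E).
  by apply/measurable_EFinP; exact: exprn_measurable.
have mXphi m : measurable_fun setT (fun x : R => (x ^+ m * phi x)%:E).
  apply/measurable_EFinP; apply: measurable_funM; first exact: exprn_measurable.
  exact: measurable_normal_pdf.
have Xphi_ge0 m (x : R) : ~~ odd m -> (0 <= (x ^+ m * phi x)%:E)%E.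
  move=> m_even; rewrite lee_fin mulr_ge0 ?normal_pdf_ge0//.
  exact: exprn_even_ge0.
rewrite !ge0_integral_normal_prob//; [|by move=> x; exact: xn_ge0..].
under eq_integral do rewrite -EFinM.
under [X in (_ <= _ * X)%E]eq_integral do rewrite -EFinM.
pose I (k : nat) := `[(- k%:R)%R, k%:R : R]%classic.
have I_cover : \bigcup_k I k = setT by rewrite (bigcup_itvT true false).
have I_nd : nondecreasing_seq I.
  move=> i j ij; rewrite subsetEset => x; rewrite /I/= !in_itv/=.
  move=> /andP[xi xj]; have ijR : (i%:R : R) <= j%:R by rewrite ler_nat.
  by rewrite (le_trans _ xi) ?lerN2//= (le_trans xj).
rewrite -I_cover.
have cvgI : (\int[lebesgue_measure]_(x in I k) (x ^+ n.+2 * phi x)%:E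
    @[k --> \oo] --> \int[lebesgue_measure]_(x in \bigcup_k I k)
    (x ^+ n.+2 * phi x)%:E)%E.
  apply: ge0_nondecreasing_set_cvg_integral => //.
  - by move=> k; exact: measurable_itv.
  - by move=> k; apply: measurable_funTS; exact: mXphi.
  - by move=> k x _; exact: Xphi_ge0.
rewrite -(cvg_lim _ cvgI)//; apply: lime_le.
  by apply/cvg_ex; eexists; exact: cvgI.
near=> k; have k0 : 0 < (k%:R : R) by rewrite ltr0n; near: k; exists 1%N.
apply: (le_trans (std_normal_moment_le_itv n_even k0)).
apply: lee_wpmul2l => //; rewrite I_cover.
apply: ge0_subset_integral => //; first exact: mXphi.
by move=> x _; exact: Xphi_ge0.
Unshelve. all: by end_near. Qed.

Lemma standard_normal_integral {d : measure_display} {T : measurableType d}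
    {R : realType} (P : probability T R) (X : {RV P >-> R}) (n : nat) :
  standard_normal X -> ~~ odd n ->
  (\int[P]_t (X t ^+ n)%:E = \int[normal_prob (0 : R) 1]_x (x ^+ n)%:E)%E.
Proof.
move=> lawX n_even.
(* [X] is recast with values in [measurableTypeR R], so that its distribution and [normal_prob] can
   be compared as measures. *)
have mX : @measurable_fun _ _ T (measurableTypeR R) setT X.
  by move=> _ B mB; apply: (@measurable_funPT _ _ _ _ X measurableT B).
pose X' : {mfun T >-> measurableTypeR R} :=
  @mfun_Sub _ _ T (measurableTypeR R) X (mem_set mX).
rewrite -[LHS](@ge0_integral_distribution _ _ _ _ _ P X'
  (fun x : R => (x ^+ n)%:E)) => [||x] /=.
- by apply: eq_measure_integral => A mA _; exact: lawX.
- by apply/measurable_EFinP; exact: exprn_measurable.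
- by rewrite lee_fin exprn_even_ge0.
Qed.

Lemma standard_normal_sqr {d : measure_display} {T : measurableType d}
    {R : realType} (P : probability T R) (X : {RV P >-> R}) :
  standard_normal X -> (\int[P]_t (X t ^+ 2)%:E <= 1)%E.
Proof.
move=> lawX; rewrite standard_normal_integral//.
apply: le_trans (@std_normal_moment_le R 0 isT) _.
under eq_integral do rewrite expr0.
rewrite mul1e (_ : (fun=> 1%:E) = cst 1%:E)// integral_cst// mul1e.
exact: probability_le1.
Qed.

Lemma standard_normal_expr4 {d : measure_display} {T : measurableType d}
    {R : realType} (P : probability T R) (X : {RV P >-> R}) :
  standard_normal X -> (\int[P]_t (X t ^+ 4)%:E <= 3%:E)%E.
Proof.
move=> lawX; rewrite standard_normal_integral//.
apply: le_trans (@std_normal_moment_le R 2 isT) _.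
rewrite -[leRHS]mule1; apply: lee_wpmul2l => //.
by rewrite -(standard_normal_integral lawX)// standard_normal_sqr.
Qed.

(** * Squared Euclidean norms and Lipschitz bounds *)

Definition sqnorm {R : realType} {N n : nat} (x : 'M[R]_(N, n)) : R :=
  \sum_(i < N) \sum_(j < n) x i j ^+ 2.

Lemma sqnorm_ge0 {R : realType} {N n : nat} (x : 'M[R]_(N, n)) : 0 <= sqnorm x.
Proof. by apply: sumr_ge0 => i _; apply: sumr_ge0 => j _; exact: sqr_ge0. Qed.

Lemma enorm_sqr {R : realType} {N n : nat} (x : 'M[R]_(N, n)) :
  enorm x ^+ 2 = sqnorm x.
Proof. by rewrite sqr_sqrtr// sqnorm_ge0. Qed.

Lemma sqrD_le {R : realDomainType} (a b : R) :
  (a + b) ^+ 2 <= 2 * (a ^+ 2 + b ^+ 2).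
Proof. have := sqr_ge0 (a - b); nra. Qed.

Lemma sqnormD_le {R : realType} {N n : nat} (y y' : 'M[R]_(N, n)) :
  sqnorm (y + y') <= 2 * (sqnorm y + sqnorm y').
Proof.
rewrite -big_split mulr_sumr/=; apply: ler_sum => a _.
rewrite -big_split mulr_sumr/=; apply: ler_sum => j _.
by rewrite mxE sqrD_le.
Qed.

Lemma sqnormZ {R : realType} {N n : nat} (c : R) (y : 'M[R]_(N, n)) :
  sqnorm (c *: y) = c ^+ 2 * sqnorm y.
Proof.
rewrite /sqnorm mulr_sumr; apply: eq_bigr => a _; rewrite mulr_sumr.
by apply: eq_bigr => j _; rewrite mxE exprMn.
Qed.

Lemma sqnormN {R : realType} {N n : nat} (y : 'M[R]_(N, n)) :
  sqnorm (- y) = sqnorm y.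
Proof. by rewrite -scaleN1r sqnormZ sqrrN expr1n mul1r. Qed.

Lemma sqnorm0 {R : realType} {N n : nat} : sqnorm (0 : 'M[R]_(N, n)) = 0.
Proof. by rewrite -(scale0r (0 : 'M[R]_(N, n))) sqnormZ expr0n mul0r. Qed.

(* Young's inequality, with the weights that turn the factor [k] into [k + 1]. *)
Lemma sqnormD_le_weighted {R : realType} {N n : nat} (k : nat)
    (y y' : 'M[R]_(N, n)) (c : R) :
  0 <= c -> (k = 0%N -> y = 0) -> sqnorm y <= k%:R * c ->
  sqnorm (y + y') <= k.+1%:R * (c + sqnorm y').
Proof.
case: k => [c_ge0 /(_ erefl) -> _|k c_ge0 _ yc].
  by rewrite add0r mul1r lerDr.
have k_gt0 : 0 < k.+1%:R :> R by rewrite ltr0n.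
rewrite -(ler_pM2l k_gt0); set K := k.+1%:R in k_gt0 yc *.
have -> : k.+2%:R = K + 1 by rewrite /K natr1.
apply: (@le_trans _ _ ((K + 1) * (sqnorm y + K * sqnorm y'))); last first.
  have : 0 <= (K + 1) * (K * c - sqnorm y).
    by rewrite mulr_ge0 ?subr_ge0// addr_ge0// ltW.
  by lra.
rewrite /sqnorm mulrDr mulrA !mulr_sumr -big_split/=; apply: ler_sum => a _.
rewrite !mulr_sumr -big_split/=; apply: ler_sum => j _; rewrite mxE.
(* The two sides differ by exactly this square. *)
have := sqr_ge0 (y a j - K * y' a j); lra.
Qed.

Lemma sqnorm_block_vec {R : realType} {N n : nat} (i : 'I_N) (g : 'I_n -> R) :
  sqnorm (block_vec i g) = \sum_j g j ^+ 2.
Proof.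
rewrite /sqnorm (bigD1 i)//= [X in _ + X]big1 => [|a /negbTE ai].
  by rewrite addr0; apply: eq_bigr => j _; rewrite mxE eqxx.
by apply: big1 => j _; rewrite mxE ai expr0n.
Qed.

(** [lipschitz_with] puts no sign on its constant; the measurability argument divides by [2 * M + 1]
    and wants [M] nonnegative. *)
Lemma lipschitz_with_norm {R : realType} {N n : nat} (L : R)
    (f : 'M[R]_(N, n) -> R) : lipschitz_with L f -> lipschitz_with `|L| f.
Proof.
move=> fL x y; apply: le_trans (fL x y) _.
by rewrite ler_wpM2r ?ler_norm// sqrtr_ge0.
Qed.

Lemma lipschitz_with_sqr {R : realType} {N n : nat} (L : R)
    (f : 'M[R]_(N, n) -> R) : lipschitz_with L f ->
  forall x y, (f x - f y) ^+ 2 <= L ^+ 2 * sqnorm (x - y).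
Proof.
move=> fL x y; rewrite -enorm_sqr -exprMn -[leLHS]real_normK ?num_real//.
(* The bound [L * enorm (x - y)] is nonnegative because it dominates an absolute value. *)
by rewrite ler_pXn2r// nnegrE ?(le_trans _ (fL x y)).
Qed.

(** * Measurability of Lipschitz functions of random matrices *)

Lemma rat_mx_dense {R : realType} {N n : nat} (x : 'M[R]_(N, n)) (e : R) :
  0 < e -> exists q : 'M[rat]_(N, n), enorm (x - map_mx ratr q) < e.
Proof.
(* With every entry within [e / K], the squared distance is at most [N * n * (e / K) ^+ 2], below
   [e ^+ 2] since [N * n < K ^+ 2]. The added 1 keeps [K] positive for empty matrices. *)
move=> e_gt0; pose K : R := (N * n)%:R + 1.
have K_gt0 : 0 < K by rewrite ltr_wpDl.
have eK : 0 < e / K by rewrite divr_gt0.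
have dense i j : exists q : rat, x i j - e / K < ratr q < x i j + e / K.
  have /rat_in_itvoo[q] : x i j - e / K < x i j + e / K.
    by rewrite ltrD2l gtrN.
  by rewrite inE/= => qP; exists q.
exists (\matrix_(i, j) sval (cid (dense i j))).
rewrite -ltr_sqr ?nnegrE ?(ltW e_gt0) ?sqrtr_ge0// enorm_sqr.
have sq_le i j :
    (x - map_mx ratr (\matrix_(i, j) sval (cid (dense i j)))) i j ^+ 2 <=
    (e / K) ^+ 2.
  rewrite !mxE; case: (cid (dense i j)) => q /= /andP[q1 q2].
  rewrite -[leLHS]real_normK ?num_real// ler_pXn2r ?nnegrE// ?(ltW eK)//.
  by rewrite ler_norml; apply/andP; split; lra.
apply: (@le_lt_trans _ _ (\sum_(i < N) \sum_(j < n) (e / K) ^+ 2)).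
  by apply: ler_sum => i _; apply: ler_sum => j _; exact: sq_le.
rewrite !sumr_const !card_ord -mulrnA expr_div_n -mulr_natr mulnC.
rewrite mulrAC ltr_pdivrMr ?exprn_gt0// ltr_pM2l ?exprn_gt0//.
have : (0 : R) <= (N * n)%:R by [].
rewrite /K; nra.
Qed.

Lemma measurable_sqnorm {d : measure_display} {T : measurableType d}
    {R : realType} {N n : nat} (X : T -> 'M[R]_(N, n)) :
  (forall i j, measurable_fun setT (fun t => X t i j)) ->
  measurable_fun setT (fun t => sqnorm (X t)).
Proof.
by move=> mX; do 2 apply: measurable_sum => ?; exact: measurable_funX.
Qed.

(* For a Lipschitz [f], [f x > c] iff [f q - L |x - q| > c] for some rational
   point [q], so the preimages of the rays are countable unions. *)
Lemma lipschitz_measurable {d : measure_display} {T : measurableType d}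
    {R : realType} {N n : nat} (L : R) (f : 'M[R]_(N, n) -> R)
    (X : T -> 'M[R]_(N, n)) : lipschitz_with L f ->
  (forall i j, measurable_fun setT (fun t => X t i j)) ->
  measurable_fun setT (fun t => f (X t)).
Proof.
move=> /lipschitz_with_norm fL mX.
have {fL} [M [M_ge0 fM]] : exists M, 0 <= M /\ lipschitz_with M f.
  by exists `|L|.
pose g (q : 'M[rat]_(N, n)) t :=
  f (map_mx ratr q) - M * enorm (X t - map_mx ratr q).
have mg q : measurable_fun setT (g q).
  apply: measurable_funB => //; apply: measurable_funM => //.
  apply: (measurableT_comp (continuous_measurable_fun (@sqrt_continuous R))).
  apply: measurable_sqnorm => i j; under eq_fun do rewrite !mxE.
  exact: measurable_funB.
apply: (measurability _ (RGenOInfty.measurableE R)) => //.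
move=> /= _ [_ [c ->] <-].
rewrite [X in measurable X](_ : _ =
    \bigcup_q (setT `&` g q @^-1` `]c, +oo[%classic)).
  apply: countable_bigcupT_measurable; first exact: countableP.
  by move=> q; apply: mg => //; exact: measurable_itv.
apply/seteqP; split => t /=; rewrite in_itv/= andbT => -[].
  move=> _ cf; set e := f (X t) - c.
  (* Going from [f (X t)] to [g q t] costs [M * enorm (X t - q)] twice: once in comparing [f] at the
     two points, once in the definition of [g]. The added 1 keeps the divisor positive. *)
  have M1_gt0 : 0 < 2 * M + 1 by rewrite ltr_wpDl// mulr_ge0.
  have e_gt0 : 0 < e / (2 * M + 1) by rewrite divr_gt0// subr_gt0.
  have [q qe] := rat_mx_dense (X t) e_gt0; exists q => //; split => //=.
  rewrite in_itv/= andbT /g.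
  have := fM (X t) (map_mx ratr q); rewrite ler_norml => /andP[_].
  move: qe; rewrite ltr_pdivlMr//.
  have : 0 <= enorm (X t - map_mx ratr q) by exact: sqrtr_ge0.
  by rewrite /e; lra.
move=> q _ [_] /=; rewrite in_itv/= andbT /g => cg; split => //.
have := fM (X t) (map_mx ratr q); rewrite ler_norml => /andP[+ _].
by move: cg; lra.
Qed.

(** * Linearity of the expectation of nonnegative variables *)

Section expectation.
Context {R : realType} {d : measure_display} {T : measurableType d}.
Variable P : probability T R.

Local Notation "''E' [ t ] F" := (\int[P]_t ((F)%R)%:E)%E
  (at level 36, t name, F at level 36).

Lemma ge0_expectationZl (c : R) (X : T -> R) : measurable_fun setT X -> 0 <= c ->
  (forall t, 0 <= X t) -> 'E[t] (c * X t) = (c%:E * 'E[t] (X t))%E.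
Proof.
move=> mX c_ge0 X_ge0; rewrite -ge0_integralZl//; last first.
  by move=> t _; rewrite lee_fin.
exact/measurable_EFinP.
Qed.

Lemma ge0_expectationD (X Y : T -> R) : measurable_fun setT X ->
  measurable_fun setT Y -> (forall t, 0 <= X t) -> (forall t, 0 <= Y t) ->
  'E[t] (X t + Y t) = ('E[t] (X t) + 'E[t] (Y t))%E.
Proof.
move=> mX mY X_ge0 Y_ge0; rewrite -ge0_integralD//.
- by move=> t _; rewrite lee_fin.
- exact/measurable_EFinP.
- by move=> t _; rewrite lee_fin.
- exact/measurable_EFinP.
Qed.

Lemma ge0_expectation_sum (I : finType) (X : I -> T -> R) :
  (forall j, measurable_fun setT (X j)) -> (forall j t, 0 <= X j t) ->
  'E[t] (\sum_j X j t) = (\sum_j 'E[t] (X j t))%E.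
Proof.
move=> mX X_ge0; rewrite -ge0_integral_sum//.
- by apply: eq_integral => t _; rewrite sumEFin.
- by move=> j; exact/measurable_EFinP.
- by move=> j t _; rewrite lee_fin.
Qed.

End expectation.

(** * Values at the last selection of an agent, and the final arithmetic *)

Definition at_last {A : Type} {N : nat} (a : nat -> A) (b : A)
    (s : nat -> 'I_N) (i : 'I_N) (k : nat) : A :=
  if last_selected s i k is Some l then a l else b.

(** The recursion behind all inductions on the previous query, its iterate and its direction; the
    default [b] stands for the initial query. *)
Lemma at_lastS {A : Type} {N : nat} (a : nat -> A) (b : A) (s : nat -> 'I_N)
    (i : 'I_N) (k : nat) :
  at_last a b s i k.+1 = if s k == i then a k else at_last a b s i k.
Proof. by rewrite /at_last /=; case: (s k == i). Qed.

Lemma map_at_last {A B : Type} {N : nat} (h : A -> B) (a : nat -> A) (b : A)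
    (s : nat -> 'I_N) (i : 'I_N) (k : nat) :
  h (at_last a b s i k) = at_last (h \o a) (h b) s i k.
Proof. by rewrite /at_last; case: last_selected. Qed.

Lemma pmin_le {R : realType} {N : nat} (p : 'I_N -> R) (i : 'I_N) : pmin p <= p i.
Proof. exact: bigmin_le. Qed.

(** The assembly for one agent, done by monotonicity because [S] and [y] may be infinite. Here [z],
    [z2], [u], [y] stand for the expectations of [|u_k|^2], [|u_k|^4], [|u_l|^2] and [D_k], and [n],
    [m2], [n], [S] for their bounds. *)
Lemma weighted_moments_le {R : realType} (p c b n : R) (m2 S z z2 y u : \bar R) :
  0 <= p -> 0 <= c -> 0 <= b ->
  (0 <= z)%E -> (0 <= y)%E -> (0 <= u)%E ->
  (z <= n%:E)%E -> (z2 <= m2)%E -> (u <= n%:E)%E -> (y <= S)%E -> (0 <= m2)%E ->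
  (c%:E * (p%:E * z * y) + b%:E * (p%:E * z2 + p%:E * z * u) <=
   p%:E * (c%:E * (n%:E * S) + b%:E * (m2 + n%:E * n%:E)))%E.
Proof.
move=> p_ge0 c_ge0 b_ge0 z_ge0 y_ge0 u_ge0 zn z2m un yS m2_ge0.
have n_ge0 : (0 <= n%:E)%E := le_trans z_ge0 zn.
have S_ge0 : (0 <= S)%E := le_trans y_ge0 yS.
rewrite (ge0_muleDr p%:E); last 2 first.
- by rewrite !mule_ge0.
- by rewrite mule_ge0 ?adde_ge0 ?mule_ge0.
apply: leeD.
  rewrite [leRHS]muleCA; apply: lee_wpmul2l; first by rewrite lee_fin.
  by rewrite -muleA; apply: lee_wpmul2l; [rewrite lee_fin|exact: lee_pmul].
rewrite [leRHS]muleCA; apply: lee_wpmul2l; first by rewrite lee_fin.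
rewrite ge0_muleDr ?mule_ge0//; apply: leeD.
  by apply: lee_wpmul2l; first by rewrite lee_fin.
by rewrite -muleA; apply: lee_wpmul2l; [rewrite lee_fin|exact: lee_pmul].
Qed.

(** * Sigma-algebras of the elementary sources of randomness *)

Section sources.
Context {d : measure_display} {T : measurableType d} {N nbar : nat}.
Context {R : realType}.
Variables (idx : nat -> T -> 'I_N).
Variables (z : nat -> 'I_nbar -> T -> R) (w : 'I_N -> 'I_nbar -> T -> R).
Hypothesis idx_meas : forall k i, measurable (idx k @^-1` [set i]).
Hypothesis z_meas : forall k j, measurable_fun setT (z k j).
Hypothesis w_meas : forall i j, measurable_fun setT (w i j).

Lemma source_sigma_measurable t : source_sigma idx z w t `<=` measurable.
Proof.
case: t => [[k|[k j]]|[i j]] _ [B mB <-].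
(* The set of agents is finite, so any preimage is a finite union of preimages of singletons. *)
- rewrite setTI (_ : _ @^-1` _ = \bigcup_(i in B) idx k @^-1` [set i]).
    by apply: fin_bigcup_measurable => // i _; exact: idx_meas.
  by apply/seteqP; split => [x Bx|x [i Bi /= ->]]; [exists (idx k x)|].
- exact: z_meas.
- exact: w_meas.
Qed.

Lemma source_sigma_setI t : setI_closed (source_sigma idx z w t).
Proof.
case: t => [[k|[k j]]|[i j]] _ _ [A mA <-] [B mB <-]; rewrite !setTI;
  exists (A `&` B); rewrite ?setTI// ?preimage_setI//; exact: measurableI.
Qed.

Lemma source_sigma_setT t : source_sigma idx z w t setT.
Proof. by case: t => [[k|[k j]]|[i j]]; exists setT; rewrite ?setTI. Qed.

Local Notation dep := (depends_on (source_sigma idx z w)).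

Lemma source_sigma_sub_space S t A : S t ->
  source_sigma idx z w t A ->
  measurable (A : set (sub_space (source_sigma idx z w) S)).
Proof. by move=> St FA; apply: sub_sigma_algebra; exists t. Qed.

Lemma dep_idx (S : set (source N nbar)) k (i : 'I_N) :
  S (inl (inl k)) -> dep S (fun t => idx k t == i).
Proof.
move=> Sk; apply: (measurable_fun_bool true); rewrite setTI.
apply: (source_sigma_sub_space Sk); exists [set i] => //; rewrite setTI.
by apply/seteqP; split => x /eqP.
Qed.

Lemma dep_z (S : set (source N nbar)) k j : S (inl (inr (k, j))) -> dep S (z k j).
Proof.
by move=> Sk _ B mB; apply: (source_sigma_sub_space Sk); exists B.
Qed.

Lemma dep_w (S : set (source N nbar)) i j : S (inr (i, j)) -> dep S (w i j).
Proof.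
by move=> Sk _ B mB; apply: (source_sigma_sub_space Sk); exists B.
Qed.

(** The last selection time is itself random, so [S] must contain the selections before [k] besides
    the sources of the values [a l]. *)
Lemma dep_at_last {d' : measure_display} {T' : measurableType d'}
    (S : set (source N nbar)) (a : nat -> T -> T') (b : T -> T') i k :
  (forall l, (l < k)%N -> S (inl (inl l)) /\ dep S (a l)) -> dep S b ->
  dep S (fun t => at_last (a ^~ t) (b t) (idx ^~ t) i k).
Proof.
elim: k => [//|k IH] Sa Sb; under eq_fun do rewrite at_lastS.
have [Sk ak] := Sa k (ltnSn k).
apply: measurable_fun_ifT => //; first exact: dep_idx.
by apply: IH => // l lk; apply: Sa; rewrite ltnS ltnW.
Qed.

End sources.

(** * Measurability along the run and pathwise bounds *)

Section run.
Context {R : realType} {N nbar : nat}.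
Context {d : measure_display} {T : measurableType d}.
Variables (f : 'M[R]_(N, nbar) -> R) (L0 alpha mu : R) (x0 : 'M[R]_(N, nbar)).
Variables (idx : nat -> T -> 'I_N).
Variables (z : nat -> 'I_nbar -> T -> R) (w : 'I_N -> 'I_nbar -> T -> R).
Variable x : nat -> T -> 'M[R]_(N, nbar).
Hypothesis idx_meas : forall k i, measurable (idx k @^-1` [set i]).
Hypothesis z_meas : forall k j, measurable_fun setT (z k j).
Hypothesis w_meas : forall i j, measurable_fun setT (w i j).
Hypothesis f_lip : lipschitz_with L0 f.
Hypothesis x_run : forall t, residual_feedback_run f alpha mu x0 (idx ^~ t)
  (fun k j => z k j t) (fun i j => w i j t) (x ^~ t).

Local Notation dep := (depends_on (source_sigma idx z w)).

(** The information available when step [k] begins. The selection and the direction of time [k] are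
    left out, which is what makes them independent of it. *)
Definition past (k : nat) : set (source N nbar) :=
  [set s | match s with
           | inl (inl l) | inl (inr (l, _)) => (l < k)%N
           | inr _ => True
           end].

Definition dir (k : nat) (t : T) : 'M[R]_(N, nbar) :=
  block_vec (idx k t) (fun j => z k j t).

Definition init_dir (i : 'I_N) (t : T) : 'M[R]_(N, nbar) :=
  block_vec i (fun j => w i j t).

Definition grad_at (i : 'I_N) (k : nat) (t : T) : 'M[R]_(N, nbar) :=
  residual_grad f mu x0 (idx ^~ t) (fun l j => z l j t) (fun a j => w a j t)
    (x ^~ t) i k.

Definition step (k : nat) (t : T) : 'M[R]_(N, nbar) := grad_at (idx k t) k t.

Definition query (k : nat) (t : T) : R := f (x k t + mu *: dir k t).

Definition previous (i : 'I_N) (k : nat) (t : T) : R :=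
  at_last (query ^~ t) (f (x0 + mu *: init_dir i t)) (idx ^~ t) i k.

Definition last_iterate (i : 'I_N) (k : nat) (t : T) : 'M[R]_(N, nbar) :=
  at_last (x ^~ t) x0 (idx ^~ t) i k.

Definition last_dir (i : 'I_N) (k : nat) (t : T) : 'M[R]_(N, nbar) :=
  at_last (dir ^~ t) (init_dir i t) (idx ^~ t) i k.

(* The sum of [|G_l|^2] over the times [l < k] not before the last selection of
   agent [i]. *)
Fixpoint drift (i : 'I_N) (k : nat) (t : T) : R :=
  if k is l.+1
  then (if idx l t == i then 0 else drift i l t) + sqnorm (step l t)
  else 0.

Lemma grad_atE i k t :
  grad_at i k t = ((query k t - previous i k t) / mu) *: dir k t.
Proof. by rewrite /grad_at /residual_grad /previous /at_last. Qed.

Lemma previousE i k t :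
  previous i k t = f (last_iterate i k t + mu *: last_dir i k t).
Proof.
by rewrite /previous /last_iterate /last_dir /at_last; case: last_selected.
Qed.

Lemma iterate0 t : x 0 t = x0. Proof. by have [] := x_run t. Qed.

Lemma iterateS k t : x k.+1 t = x k t - alpha *: step k t.
Proof. by have [_ ->] := x_run t. Qed.

(** Row [a] of [dir k t] vanishes unless [a] is selected, so the random agent in [step] may be
    replaced by the fixed [a], and measurability concerns one agent at a time. *)
Lemma step_entry k t a j :
  step k t a j = (query k t - previous a k t) / mu * dir k t a j.
Proof.
rewrite /step grad_atE !mxE; case: eqP => [<-//|_]; by rewrite !mulr0.
Qed.

Lemma subset_past k l : (k <= l)%N -> past k `<=` past l.
Proof.
by move=> kl [[m|[m j]]|[i j]] //= mk; exact: leq_trans mk kl.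
Qed.

Lemma past_dir k a j : dep (past k.+1) (fun t => dir k t a j).
Proof.
under eq_fun do rewrite mxE.
apply: measurable_fun_ifT => //; last by apply: dep_z; exact: ltnSn.
rewrite (_ : (fun _ => _) = (fun t => idx k t == a)).
  by apply: dep_idx; exact: ltnSn.
by apply/funext => t; rewrite eq_sym.
Qed.

Lemma past_init_dir k i a j : dep (past k) (fun t => init_dir i t a j).
Proof.
under eq_fun do rewrite mxE.
case: (a == i); last exact: measurable_cst.
exact: (@dep_w _ _ _ _ _ idx z w (past k) i j Logic.I).
Qed.

Lemma past_lipschitz k (X : T -> 'M[R]_(N, nbar)) :
  (forall a j, dep (past k) (fun t => X t a j)) ->
  dep (past k) (fun t => f (X t)).
Proof. exact: lipschitz_measurable f_lip. Qed.

(** Here and in the next two lemmas the measurability of the iterates is assumed, since they feed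
    the strong induction of [past_iterate]. *)
Lemma past_query k : (forall a j, dep (past k) (fun t => x k t a j)) ->
  dep (past k.+1) (query k).
Proof.
move=> xk; apply: past_lipschitz => a j.
under eq_fun do rewrite mxE [X in _ + X]mxE.
apply: measurable_funD.
  exact: depends_onW (subset_past (leqnSn k)) (xk a j).
by apply: measurable_funM => //; exact: past_dir.
Qed.

Lemma past_previous i k :
  (forall l, (l < k)%N -> forall a j, dep (past l) (fun t => x l t a j)) ->
  dep (past k) (previous i k).
Proof.
move=> xl; apply: dep_at_last => [l lk|]; last first.
  apply: past_lipschitz => a j; under eq_fun do rewrite mxE [X in _ + X]mxE.
  apply: measurable_funD => //; apply: measurable_funM => //.
  exact: past_init_dir.
split; first exact: lk.
exact: depends_onW (subset_past lk) (past_query (xl l lk)).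
Qed.

Lemma past_step_entry k a j :
  (forall l, (l <= k)%N -> forall a j, dep (past l) (fun t => x l t a j)) ->
  dep (past k.+1) (fun t => step k t a j).
Proof.
move=> xl; under eq_fun do rewrite step_entry.
apply: measurable_funM; last exact: past_dir.
apply: measurable_funM => //; apply: measurable_funB.
  exact: past_query (xl k (leqnn k)).
apply: depends_onW (subset_past (leqnSn k)) _; apply: past_previous => l lk.
by apply: xl; exact: ltnW.
Qed.

(** Strong induction, as the estimate of a step may reach back to a query at any earlier time. *)
Lemma past_iterate k a j : dep (past k) (fun t => x k t a j).
Proof.
elim/ltn_ind: k a j => -[_ a j|k IH a j].
  by under eq_fun do rewrite iterate0; exact: measurable_cst.
under eq_fun do rewrite iterateS mxE [X in _ + X]mxE [X in _ - X]mxE.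
apply: measurable_funB.
  by apply: depends_onW (subset_past (leqnSn k)) _; exact: IH.
apply: measurable_funM => //; apply: past_step_entry => l lk; exact: IH.
Qed.

Lemma past_step k a j : dep (past k.+1) (fun t => step k t a j).
Proof. by apply: past_step_entry => l _; exact: past_iterate. Qed.

Lemma past_sqnorm_step k : dep (past k.+1) (fun t => sqnorm (step k t)).
Proof. by apply: measurable_sqnorm => a j; exact: past_step. Qed.

Lemma past_drift i k : dep (past k) (drift i k).
Proof.
elim: k => [|k IH]; first exact: measurable_cst.
apply: measurable_funD; last exact: past_sqnorm_step.
apply: measurable_fun_ifT => //; first by apply: dep_idx; exact: ltnSn.
exact: depends_onW (subset_past (leqnSn k)) IH.
Qed.

Lemma past_last_dir i k : dep (past k) (fun t => sqnorm (last_dir i k t)).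
Proof.
under eq_fun do rewrite /last_dir map_at_last.
apply: dep_at_last => [l lk|].
  split; first exact: lk.
  apply: depends_onW (subset_past lk) _.
  by apply: measurable_sqnorm => a j; exact: past_dir.
by apply: measurable_sqnorm => a j; exact: past_init_dir.
Qed.

Lemma drift_ge0 i k t : 0 <= drift i k t.
Proof.
by elim: k => //= k IH; rewrite addr_ge0 ?sqnorm_ge0//; case: ifP.
Qed.

(** Cauchy-Schwarz over the steps since the last selection, run one step at a time: a selection of
    [i] restarts both sides, and any other step adds its increment through [sqnormD_le_weighted]. *)
Lemma iterate_drift i k t :
  sqnorm (x k t - last_iterate i k t) <= k%:R * (alpha ^+ 2 * drift i k t).
Proof.
elim: k => [|k IH]; first by rewrite /last_iterate/= iterate0 subrr sqnorm0 mul0r.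
rewrite /last_iterate at_lastS iterateS /= mulrDr -sqnormZ addrAC.
rewrite -[X in _ <= _ * (_ + X)]sqnormN.
case: eqP => [_|_].
  rewrite subrr add0r mulr0 add0r -[leLHS]mul1r.
  by rewrite ler_wpM2r ?sqnorm_ge0// ler1n.
apply: sqnormD_le_weighted => //; first by rewrite mulr_ge0 ?sqr_ge0 ?drift_ge0.
by move=> k0; rewrite k0 iterate0 subrr.
Qed.

(** Which block is filled does not change the norm of [u_k]. Written without the selected agent, its
    square depends on the Gaussian coordinates alone and is independent of [idx k]. *)
Definition dir_sq (k : nat) (t : T) : R := \sum_j z k j t ^+ 2.

Lemma sqnorm_dir k t : sqnorm (dir k t) = dir_sq k t.
Proof. exact: sqnorm_block_vec. Qed.

Lemma sqnorm_step_le i k t : 0 < mu -> idx k t = i ->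
  sqnorm (step k t) <=
    2 * L0 ^+ 2 * alpha ^+ 2 * k%:R / mu ^+ 2 * (dir_sq k t * drift i k t) +
    4 * L0 ^+ 2 *
      (dir_sq k t ^+ 2 + dir_sq k t * sqnorm (last_dir i k t)).
Proof.
move=> mu_gt0 ki; rewrite /step ki grad_atE sqnormZ sqnorm_dir expr_div_n.
have Z_ge0 : 0 <= dir_sq k t by rewrite -sqnorm_dir sqnorm_ge0.
have mu2_gt0 : 0 < mu ^+ 2 by rewrite exprn_gt0.
rewrite previousE.
have := lipschitz_with_sqr f_lip (x k t + mu *: dir k t)
  (last_iterate i k t + mu *: last_dir i k t).
rewrite opprD addrACA -scalerBr => fd.
have L2_ge0 : 0 <= L0 ^+ 2 := sqr_ge0 _.
have {fd} := le_trans fd (ler_wpM2l L2_ge0 (sqnormD_le _ _)).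
rewrite sqnormZ.
have := sqnormD_le (dir k t) (- last_dir i k t); rewrite sqnormN sqnorm_dir.
have := iterate_drift i k t.
set Q := (_ - _) ^+ 2; set S := sqnorm (_ - _); set S' := sqnorm (_ - _).
set U := sqnorm _; set Z := dir_sq _ _; set D := drift _ _ _ => gap dirs fd.
(* One factor 2 comes from separating iterates from directions, a second one from separating the two
   directions; the latter part carries [mu ^+ 2], which cancels. *)
apply: (@le_trans _ _ ((L0 ^+ 2 * (2 * (k%:R * (alpha ^+ 2 * D) +
    mu ^+ 2 * (2 * (Z + U))))) / mu ^+ 2 * Z)).
  rewrite ler_wpM2r// ler_wpM2r ?invr_ge0 ?(ltW mu2_gt0)//.
  apply: le_trans fd _; rewrite ler_wpM2l// ler_wpM2l// lerD//.
  by rewrite ler_wpM2l// ltW.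
rewrite le_eqVlt; apply/orP; left; apply/eqP; field.
by rewrite gt_eqF.
Qed.

(** * Independence of the current selection and direction from the past *)

Variables (P : probability T R) (p : 'I_N -> R).
Hypothesis idx_law : forall k i, P (idx k @^-1` [set i]) = (p i)%:E.
Hypothesis z_sqr : forall k j, (\int[P]_t (z k j t ^+ 2)%:E <= 1)%E.
Hypothesis z_expr4 : forall k j, (\int[P]_t (z k j t ^+ 4)%:E <= 3%:E)%E.
Hypothesis w_sqr : forall i j, (\int[P]_t (w i j t ^+ 2)%:E <= 1)%E.
Hypothesis indep : mutually_independent P (source_sigma idx z w).
Hypothesis p_prob : probability_vector p.
Hypothesis mu_gt0 : 0 < mu.

Local Notation "''E' [ t ] F" := (\int[P]_t ((F)%R)%:E)%E
  (at level 36, t name, F at level 36).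

Lemma dep_measurable S (X : T -> R) : dep S X -> measurable_fun setT X.
Proof. by apply: depends_on_measurable; exact: source_sigma_measurable. Qed.

Lemma dep_expectationM (S S' : set (source N nbar)) (X Y : T -> R) :
  S `&` S' = set0 -> dep S X -> dep S' Y ->
  (forall t, 0 <= X t) -> (forall t, 0 <= Y t) ->
  ('E[t] (X t * Y t) = 'E[t] (X t) * 'E[t] (Y t))%E.
Proof.
apply: expectation_depends_onM => //; first exact: source_sigma_measurable.
- exact: source_sigma_setI.
- exact: source_sigma_setT.
Qed.

Lemma p_le1 i : p i <= 1.
Proof. by rewrite -lee_fin -(idx_law 0 i) probability_le1. Qed.

(** A real-valued indicator, so that integrals over a selection event become expectations of
    products. *)
Definition sel (i : 'I_N) (k : nat) (t : T) : R := (idx k t == i)%:R.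

Lemma dep_sel (S : set (source N nbar)) i k : S (inl (inl k)) -> dep S (sel i k).
Proof.
move=> Sk; rewrite /sel.
rewrite (_ : (fun _ => _) = (fun t => if idx k t == i then 1 else 0)).
  by apply: measurable_fun_ifT => //; exact: dep_idx.
by apply/funext => t; case: eqP.
Qed.

Lemma mem_selected i k t : (t \in idx k @^-1` [set i]) = (idx k t == i).
Proof. by apply/idP/eqP; rewrite inE. Qed.

Lemma measurable_sel i k : measurable_fun setT (sel i k).
Proof. exact: dep_measurable (@dep_sel setT i k Logic.I). Qed.

Lemma measurable_selN i k : measurable_fun setT (fun t => 1 - sel i k t).
Proof. by apply: measurable_funB => //; exact: measurable_sel. Qed.

Lemma measurable_last_dir i k :
  measurable_fun setT (fun t => sqnorm (last_dir i k t)).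
Proof. exact: dep_measurable (@past_last_dir i k). Qed.

Lemma expectation_sel i k : 'E[t] (sel i k t) = (p i)%:E.
Proof.
rewrite -(idx_law k i) -[in RHS](setIT (_ @^-1` _)) -integral_indic//.
by apply: eq_integral => t _; rewrite indicE mem_selected.
Qed.

Lemma expectation_selN i k : 'E[t] (1 - sel i k t) = (1 - p i)%:E.
Proof.
transitivity (P (~` (idx k @^-1` [set i]))).
  rewrite -[in RHS](setIT (~` _)) -integral_indic//; last exact: measurableC.
  apply: eq_integral => t _; rewrite indicE in_setC mem_selected /sel.
  by case: eqP => _; rewrite ?subrr ?subr0.
by rewrite probability_setC// idx_law.
Qed.

Lemma integral_selected (i : 'I_N) (k : nat) (h : T -> R) :
  (\int[P]_(t in idx k @^-1` [set i]) (h t)%:E)%E = 'E[t] (sel i k t * h t).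
Proof.
rewrite integral_mkcond; apply: eq_integral => t _; rewrite patchE /sel.
by rewrite mem_selected; case: eqP => _; rewrite ?mul1r ?mul0r.
Qed.

Lemma sel_ge0 i k t : 0 <= sel i k t. Proof. exact: ler0n. Qed.

Lemma selN_ge0 i k t : 0 <= 1 - sel i k t.
Proof. by rewrite /sel; case: eqP => _; rewrite ?subrr ?subr0. Qed.

Lemma if_sel i k t (a b : R) :
  (if idx k t == i then a else b) = sel i k t * a + (1 - sel i k t) * b.
Proof. by rewrite /sel; case: eqP => _ /=; ring. Qed.

Definition dir_sources (k : nat) : set (source N nbar) :=
  [set s | if s is inl (inr (l, _)) then l = k else False].

Lemma dep_dir_sq k : dep (dir_sources k) (dir_sq k).
Proof. by apply: measurable_sum => j; apply: measurable_funX; exact: dep_z. Qed.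

Lemma measurable_dir_sq k : measurable_fun setT (dir_sq k).
Proof. exact: dep_measurable (@dep_dir_sq k). Qed.

Lemma dir_sq_ge0 k t : 0 <= dir_sq k t.
Proof. by apply: sumr_ge0 => j _; exact: sqr_ge0. Qed.

Lemma past_selN_disjoint k : [set inl (inl k)] `&` past k = set0.
Proof. by apply/seteqP; split => // s [-> /=]; rewrite ltnn. Qed.

Lemma expectation_selNM i k (Y : T -> R) : dep (past k) Y ->
  (forall t, 0 <= Y t) ->
  'E[t] ((1 - sel i k t) * Y t) = ((1 - p i)%:E * 'E[t] (Y t))%E.
Proof.
move=> pY Y_ge0; rewrite -(expectation_selN i k).
apply: dep_expectationM (past_selN_disjoint k) _ pY (selN_ge0 i k) Y_ge0.
by apply: measurable_funB => //; exact: dep_sel.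
Qed.

(** The selection at time [k], the direction at time [k] and the past use three disjoint sets of
    sources, so independence applies twice. *)
Lemma expectation_fresh i k (h Y : T -> R) : dep (dir_sources k) h ->
  dep (past k) Y -> (forall t, 0 <= h t) -> (forall t, 0 <= Y t) ->
  'E[t] (sel i k t * h t * Y t) = ((p i)%:E * 'E[t] (h t) * 'E[t] (Y t))%E.
Proof.
move=> zh pY h_ge0 Y_ge0; rewrite -(expectation_sel i k).
have ksel : dep [set inl (inl k)] (sel i k) by exact: dep_sel.
rewrite -(dep_expectationM _ ksel zh)//; last first.
  by apply/seteqP; split => // s [-> /=].
apply: (dep_expectationM (S := [set inl (inl k)] `|` dir_sources k)) pY _ Y_ge0.
- apply/seteqP; split => // -[[l|[l j]]|[a j]] //= -[[]//].
    by move=> [->]; rewrite ltnn.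
  by move=> ->; rewrite ltnn.
- apply: measurable_funM; first exact: depends_onW ksel.
  exact: depends_onW zh.
- by move=> t; rewrite mulr_ge0 ?sel_ge0.
Qed.

(** * Moments of the exploration directions *)

Lemma expectation_dir_sq k : ('E[t] (dir_sq k t) <= nbar%:R%:E)%E.
Proof.
rewrite ge0_expectation_sum => [|j|j t]; last exact: sqr_ge0.
  apply: (@le_trans _ _ (\sum_(j < nbar) 1%:E)%E); first exact: lee_sum.
  by rewrite sumEFin sumr_const card_ord.
exact: measurable_funX.
Qed.

Lemma expectation_init_dir i :
  ('E[t] (sqnorm (init_dir i t)) <= nbar%:R%:E)%E.
Proof.
under eq_integral do rewrite sqnorm_block_vec.
rewrite ge0_expectation_sum => [|j|j t]; last exact: sqr_ge0.
  apply: (@le_trans _ _ (\sum_(j < nbar) 1%:E)%E); first exact: lee_sum.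
  by rewrite sumEFin sumr_const card_ord.
exact: measurable_funX.
Qed.

(** Expanding the square over pairs of coordinates, diagonal terms contribute at most 3 and the
    others, by independence, at most 1. Each row sums to [nbar + 2], and [nbar * (nbar + 2)] lies
    below the stated bound. *)
Lemma expectation_dir_sq_sqr k :
  ('E[t] (dir_sq k t ^+ 2) <= ((4 + nbar%:R) ^+ 2)%:E)%E.
Proof.
have E_prod j j' : ('E[t] ((z k j t * z k j' t) ^+ 2)%R <=
    (if j == j' then 3 else 1)%:E)%E.
  case: eqP => [<-|jj'].
    by under eq_integral do rewrite -expr2 -exprM; exact: z_expr4.
  under eq_integral do rewrite exprMn.
  rewrite (dep_expectationM (S := [set inl (inr (k, j))])
    (S' := [set inl (inr (k, j'))])).
  - by rewrite -[leRHS]mule1; apply: lee_pmul => //; apply: integral_ge0 => t _;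
      rewrite lee_fin sqr_ge0.
  - by apply/seteqP; split => // s [-> []].
  - by apply: measurable_funX; exact: dep_z.
  - by apply: measurable_funX; exact: dep_z.
  - by move=> t; exact: sqr_ge0.
  - by move=> t; exact: sqr_ge0.
have mzz j j' : measurable_fun setT (fun t => (z k j t * z k j' t) ^+ 2).
  by apply: measurable_funX; exact: measurable_funM.
have sqE t : dir_sq k t ^+ 2 = \sum_j \sum_j' (z k j t * z k j' t) ^+ 2.
  rewrite expr2 mulr_suml; apply: eq_bigr => j _.
  by rewrite mulr_sumr; apply: eq_bigr => j' _; rewrite exprMn.
under eq_integral do rewrite sqE.
rewrite ge0_expectation_sum => [|j|j t]; last 2 first.
- exact: measurable_sum.
- by apply: sumr_ge0 => j' _; exact: sqr_ge0.
apply: (@le_trans _ _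
    (\sum_(j < nbar) \sum_(j' < nbar) (if j == j' then 3 else 1)%:E)%E).
  apply: lee_sum => j _; rewrite ge0_expectation_sum => [||j' t] //; last first.
    exact: sqr_ge0.
  by apply: lee_sum => j' _; exact: E_prod.
under eq_bigr do rewrite sumEFin; rewrite sumEFin lee_fin.
have rowsum (j : 'I_nbar) :
    \sum_(j' < nbar) (if j == j' then 3 else 1) = nbar%:R + 2 :> R.
  rewrite (eq_bigr (fun j' => 1 + (if j == j' then 2 else 0))); last first.
    by move=> j' _; case: eqP => _; rewrite ?addr0// -natr1 addrC.
  rewrite big_split/= sumr_const card_ord; congr (_ + _).
  by rewrite -big_mkcond/= (big_pred1 j)// => j'; rewrite eq_sym.
rewrite (eq_bigr _ (fun j _ => rowsum j)) sumr_const card_ord -mulr_natl.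
have : (0 : R) <= nbar%:R by [].
nra.
Qed.

Lemma expectation_last_dirS i k :
  'E[t] (sqnorm (last_dir i k.+1 t)) =
  ('E[t] (sel i k t * dir_sq k t) +
   'E[t] ((1 - sel i k t) * sqnorm (last_dir i k t)))%E.
Proof.
rewrite -ge0_expectationD.
- apply: eq_integral => t _; rewrite /last_dir at_lastS -sqnorm_dir -if_sel.
  by case: eqP.
- by apply: measurable_funM; [exact: measurable_sel|exact: measurable_dir_sq].
- by apply: measurable_funM; [exact: measurable_selN|exact: measurable_last_dir].
- by move=> t; rewrite mulr_ge0 ?sel_ge0 ?dir_sq_ge0.
- by move=> t; rewrite mulr_ge0 ?selN_ge0 ?sqnorm_ge0.
Qed.

Lemma expectation_fresh1 i k (h : T -> R) : dep (dir_sources k) h ->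
  (forall t, 0 <= h t) ->
  'E[t] (sel i k t * h t) = ((p i)%:E * 'E[t] (h t))%E.
Proof.
move=> zh h_ge0; have := @expectation_fresh i k h (cst 1) zh.
rewrite (_ : 'E[t] (cst 1 t) = 1%E); last first.
  rewrite -[LHS]/(\int[P]_t cst 1%:E t)%E integral_cst// mul1e.
  exact: probability_setT.
rewrite mule1 => <- //; last exact: measurable_cst.
by apply: eq_integral => t _; rewrite mulr1.
Qed.

(** By induction: the expectation at [k.+1] is the combination, with weights [p i] and [1 - p i], of
    that of [dir_sq k] and the one at [k], both at most [nbar]. *)
Lemma expectation_last_dir i k :
  ('E[t] (sqnorm (last_dir i k t)) <= nbar%:R%:E)%E.
Proof.
elim: k => [|k IH]; first exact: expectation_init_dir.
rewrite expectation_last_dirS (expectation_fresh1 i (@dep_dir_sq k)); last first.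
  exact: dir_sq_ge0.
rewrite (expectation_selNM i (@past_last_dir i k)); last first.
  by move=> t; exact: sqnorm_ge0.
have p_ge0 : (0 <= (p i)%:E)%E by rewrite lee_fin p_prob.1.
have q_ge0 : (0 <= (1 - p i)%:E)%E by rewrite lee_fin subr_ge0 p_le1.
apply: le_trans (leeD (lee_wpmul2l p_ge0 (expectation_dir_sq k))
  (lee_wpmul2l q_ge0 IH)) _.
by rewrite -!EFinM -EFinD lee_fin -mulrDl addrC subrK mul1r.
Qed.

(** * Mean squared steps and the expected drift *)

Definition step_sq (k : nat) : \bar R := 'E[t] (sqnorm (step k t)).

Lemma step_sq_ge0 k : (0 <= step_sq k)%E.
Proof. by apply: integral_ge0 => t _; rewrite lee_fin sqnorm_ge0. Qed.

Lemma measurable_sqnorm_step k : measurable_fun setT (fun t => sqnorm (step k t)).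
Proof. exact: dep_measurable (@past_sqnorm_step k). Qed.

Lemma sum_sel k t : \sum_i sel i k t = 1.
Proof.
by rewrite (bigD1 (idx k t))//= /sel eqxx big1 ?addr0// => i /negbTE;
  rewrite eq_sym => ->.
Qed.

Lemma step_sq_sum k :
  step_sq k = (\sum_i 'E[t] (sel i k t * sqnorm (step k t)))%E.
Proof.
rewrite -ge0_expectation_sum => [|i|i t].
- by apply: eq_integral => t _; rewrite -mulr_suml sum_sel mul1r.
- by apply: measurable_funM; [exact: measurable_sel|exact: measurable_sqnorm_step].
- by rewrite mulr_ge0 ?sel_ge0 ?sqnorm_ge0.
Qed.

(** The weight [p i] cancels the division in the conditional expectation; the selection events
    partition the space, and on each of them [step] is the estimate of the agent concerned. *)
Lemma mean_sq_gradE k : mean_sq_grad P p f mu x0 idx z w x k = step_sq k.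
Proof.
rewrite step_sq_sum; apply: eq_bigr => i _.
rewrite /cond_expectation idx_law/= muleA -EFinM.
rewrite (_ : (\int[P]_(t in _) _)%E = 'E[t] (sel i k t * sqnorm (step k t))).
  (* For [p i = 0] the weighted term is 0, and so is the integral over the null event. *)
  have [p0|p_neq0] := eqVneq (p i) 0; last by rewrite divff// mul1e.
  rewrite p0 mul0r mul0e; apply/esym; rewrite -integral_selected.
  apply: null_set_integral => //.
  - by apply/measurable_EFinP/measurable_funTS; exact: measurable_sqnorm_step.
  - by have := idx_law k i; rewrite p0.
rewrite -integral_selected; apply: eq_integral => t; rewrite inE/= => <-.
by rewrite enorm_sqr.
Qed.

Lemma expectation_driftS i k : 'E[t] (drift i k.+1 t) =
  (step_sq k + (1 - p i)%:E * 'E[t] (drift i k t))%E.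
Proof.
have drift_k := @past_drift i k; have drift_k0 := drift_ge0 i k.
rewrite -(expectation_selNM i drift_k drift_k0) -ge0_expectationD.
- by apply: eq_integral => t _; rewrite /= addrC if_sel mulr0 add0r.
- exact: measurable_sqnorm_step.
- apply: measurable_funM; last exact: dep_measurable drift_k.
  exact: measurable_selN.
- by move=> t; exact: sqnorm_ge0.
- by move=> t; rewrite mulr_ge0 ?selN_ge0.
Qed.

Lemma expectation_drift i k : 'E[t] (drift i k t) =
  (\sum_(0 <= m < k) ((1 - p i) ^+ m)%:E * step_sq (k - m - 1)%N)%E.
Proof.
elim: k => [|k IH].
  by rewrite big_nil integral0_eq.
(* The summand [m = 0] is the newest step; shifting the others by one absorbs the factor
   [1 - p i]. *)
rewrite expectation_driftS IH big_nat_recl//; congr (_ + _)%E.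
  by rewrite expr0 mul1e subn0 subSS subn0.
rewrite ge0_sume_distrr => [|m _]; last first.
  by rewrite mule_ge0 ?step_sq_ge0// lee_fin exprn_ge0// subr_ge0 p_le1.
by apply: eq_bigr => m _; rewrite muleA -EFinM -exprS subSS.
Qed.

(** Passing from [p i] to [pmin p] makes the bound the same for every agent, so that it factors out
    of the sum over agents. *)
Lemma expectation_drift_le i k : ('E[t] (drift i k t) <=
  \sum_(0 <= m < k) ((1 - pmin p) ^+ m)%:E * step_sq (k - m - 1)%N)%E.
Proof.
rewrite expectation_drift; apply: lee_sum => m _.
apply: lee_wpmul2r; first exact: step_sq_ge0.
have p1 : 0 <= 1 - p i by rewrite subr_ge0 p_le1.
have p_pmin : 1 - p i <= 1 - pmin p by rewrite lerD2l lerN2 pmin_le.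
by rewrite lee_fin lerXn2r// nnegrE (le_trans p1).
Qed.

(** Each agent contributes at most [p i] times the right-hand side [B], and the weights sum to 1. *)
Lemma step_sq_le k : (step_sq k <=
  (2 * nbar%:R * L0 ^+ 2 * alpha ^+ 2 * k%:R / mu ^+ 2)%:E *
    \sum_(0 <= m < k) ((1 - pmin p) ^+ m)%:E * step_sq (k - m - 1)%N +
  (4 * L0 ^+ 2 * ((4 + nbar%:R) ^+ 2 + nbar%:R ^+ 2))%:E)%E.
Proof.
set S := (\sum_(0 <= m < k) _)%E; set B := (_ + _)%E.
have S_ge0 : (0 <= S)%E.
  (* [S] dominates an expected drift, which is nonnegative; [idx 0 point] supplies an agent to speak
     of. *)
  apply: le_trans (expectation_drift_le (idx 0 point) k).
  by apply: integral_ge0 => t _; rewrite lee_fin drift_ge0.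
pose c := 2 * L0 ^+ 2 * alpha ^+ 2 * k%:R / mu ^+ 2.
have c_ge0 : 0 <= c.
  rewrite /c divr_ge0 ?sqr_ge0//.
  by do ![exact: sqr_ge0 | exact: ler0n | apply: mulr_ge0].
have b_ge0 : 0 <= 4 * L0 ^+ 2 by rewrite mulr_ge0 ?sqr_ge0.
have p_ge0 i : (0 <= (p i)%:E)%E by rewrite lee_fin p_prob.1.
have E_ge0 (X : T -> R) : (forall t, 0 <= X t) -> (0 <= 'E[t] (X t))%E.
  by move=> X_ge0; apply: integral_ge0 => t _; rewrite lee_fin.
have B_i i : ('E[t] (sel i k t * sqnorm (step k t)) <= (p i)%:E * B)%E.
  have mZ := @measurable_dir_sq k; have msel := @measurable_sel i k.
  have mD := dep_measurable (@past_drift i k).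
  have mU := @measurable_last_dir i k.
  have mZ2 : measurable_fun setT (fun t => dir_sq k t ^+ 2).
    exact: measurable_funX.
  have D_ge0 := drift_ge0 i k; have Z_ge0 := dir_sq_ge0 k.
  have U_ge0 t : 0 <= sqnorm (last_dir i k t) := sqnorm_ge0 _.
  apply: (@le_trans _ _ ('E[t] (
      c * (sel i k t * dir_sq k t * drift i k t) +
      4 * L0 ^+ 2 * (sel i k t * dir_sq k t ^+ 2 +
                     sel i k t * dir_sq k t * sqnorm (last_dir i k t))))).
    apply: ge0_le_integral => //.
    - by move=> t _; rewrite lee_fin mulr_ge0 ?sel_ge0 ?sqnorm_ge0.
    - apply/measurable_EFinP/measurable_funM => //.
      exact: measurable_sqnorm_step.
    - apply/measurable_EFinP.
      by do !(apply: measurable_funD || apply: measurable_funM).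
    (* On the selection event this is the pathwise bound; off it both sides vanish. *)
    - move=> t _; rewrite lee_fin /sel; case: eqP => /= [ki|_].
        by rewrite !mul1r sqnorm_step_le.
      by rewrite !mul0r !mulr0 addr0 mulr0 addr0.
  have mselZ : measurable_fun setT (fun t => sel i k t * dir_sq k t).
    exact: measurable_funM.
  have selZ_ge0 t : 0 <= sel i k t * dir_sq k t by rewrite mulr_ge0 ?sel_ge0.
  have mselZD : measurable_fun setT
      (fun t => sel i k t * dir_sq k t * drift i k t) by exact: measurable_funM.
  have mselZ2 : measurable_fun setT (fun t => sel i k t * dir_sq k t ^+ 2).
    exact: measurable_funM.
  have mselZU : measurable_fun setT
      (fun t => sel i k t * dir_sq k t * sqnorm (last_dir i k t)).
    exact: measurable_funM.
  have selZD_ge0 t : 0 <= sel i k t * dir_sq k t * drift i k t.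
    exact: mulr_ge0.
  have selZ2_ge0 t : 0 <= sel i k t * dir_sq k t ^+ 2.
    by rewrite mulr_ge0 ?sel_ge0 ?sqr_ge0.
  have selZU_ge0 t : 0 <= sel i k t * dir_sq k t * sqnorm (last_dir i k t).
    exact: mulr_ge0.
  rewrite ge0_expectationD; last 4 first.
  - exact: measurable_funM.
  - by apply: measurable_funM => //; exact: measurable_funD.
  - by move=> t; exact: mulr_ge0.
  - by move=> t; apply: mulr_ge0 => //; exact: addr_ge0.
  rewrite !ge0_expectationZl//; last 2 first.
  - exact: measurable_funD.
  - by move=> t; exact: addr_ge0.
  rewrite ge0_expectationD//.
  have zZ := @dep_dir_sq k.
  have zZ2 : dep (dir_sources k) (fun t => dir_sq k t ^+ 2).
    exact: measurable_funX.
  rewrite (expectation_fresh i zZ (@past_drift i k))//.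
  rewrite (expectation_fresh i zZ (@past_last_dir i k))//.
  rewrite (expectation_fresh1 i zZ2) => [|t]; last exact: sqr_ge0.
  have EZ := expectation_dir_sq k; have EZ2 := expectation_dir_sq_sqr k.
  have EU := expectation_last_dir i k; have ED := expectation_drift_le i k.
  (* One [nbar] of the leading coefficient bounds the mean of [|u_k|^2]; the summand [nbar ^+ 2] is
     the product of the bounds for [|u_k|^2] and [|u_l|^2]. *)
  have -> : B = (c%:E * (nbar%:R%:E * S) + (4 * L0 ^+ 2)%:E *
      (((4 + nbar%:R) ^+ 2)%:E + nbar%:R%:E * nbar%:R%:E))%E.
    rewrite -(EFinM nbar%:R) -expr2 -EFinD -EFinM muleA -EFinM.
    by congr (_%:E * _ + _)%E; rewrite /c; ring.
  by apply: weighted_moments_le => //; [exact: p_prob.1|exact: E_ge0..].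
rewrite step_sq_sum; apply: (@le_trans _ _ (\sum_i (p i)%:E * B)%E).
  by apply: lee_sum => i _; exact: B_i.
rewrite -ge0_sume_distrl; last by move=> i _; exact: p_ge0.
by rewrite sumEFin p_prob.2 mul1e.
Qed.

End run.

Unset Implicit Arguments.

Theorem lemma4 (R : realType) (N nbar : nat)
  (d : measure_display) (T : measurableType d) (P : probability T R)
  (p : 'I_N -> R) (idx : nat -> T -> 'I_N)
  (z : nat -> 'I_nbar -> {RV P >-> R}) (w : 'I_N -> 'I_nbar -> {RV P >-> R})
  (f : 'M[R]_(N, nbar) -> R) (L0 L1 alpha mu : R)
  (x0 : 'M[R]_(N, nbar)) (x : nat -> T -> 'M[R]_(N, nbar))
  (p_prob : probability_vector p)
  (idx_meas : forall k i, measurable (idx k @^-1` [set i]))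
  (idx_law : forall k i, P (idx k @^-1` [set i]) = (p i)%:E)
  (z_law : forall k j, standard_normal (z k j))
  (w_law : forall i j, standard_normal (w i j))
  (indep : mutually_independent P (source_sigma idx z w))
  (f_bounded : bounded_below f)
  (f_lip : lipschitz_with L0 f)
  (f_smooth : smooth_with L1 f)
  (alpha_gt0 : 0 < alpha) (mu_gt0 : 0 < mu)
  (x_run : forall t, residual_feedback_run f alpha mu x0 (idx ^~ t)
             (fun k j => z k j t) (fun i j => w i j t) (x ^~ t))
  (k : nat) (k_ge1 : (1 <= k)%N) :
  (mean_sq_grad P p f mu x0 idx z w x k <=
     (2 * nbar%:R * L0 ^+ 2 * alpha ^+ 2 * k%:R / mu ^+ 2)%:E *
       \sum_(0 <= m < k)
          ((1 - pmin p) ^+ m)%:E *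
          mean_sq_grad P p f mu x0 idx z w x (k - m - 1)%N
     + (4 * L0 ^+ 2 * ((4 + nbar%:R) ^+ 2 + nbar%:R ^+ 2))%:E)%E.
Proof.
have z_meas l j : measurable_fun setT (z l j) by exact: measurable_funPT.
have w_meas i j : measurable_fun setT (w i j) by exact: measurable_funPT.
have gradE l := mean_sq_gradE idx_meas z_meas w_meas f_lip x_run idx_law l.
(* With both sides in terms of [step_sq], what remains to supply are the Gaussian moment bounds. *)
rewrite gradE; under eq_bigr do rewrite gradE.
apply: step_sq_le => //.
- by move=> l j; exact: standard_normal_sqr.
- by move=> l j; exact: standard_normal_expr4.
- by move=> i j; exact: standard_normal_sqr.
Qed.
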